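(* Let $i\in U$ and $x\in\mathcal P$. For every $\mu<0.5$ and $\beta>0.5+\mu$, if $\mathrm{LB}_i(x)<(0.5+\mu)\cdot \mathrm{LP}_i(x)$, then 1) $\displaystyle\sum_{t\in V} x_{it}\cdot \mathbf 1[w_{it}>\beta\cdot \mathrm{LP}_i(x)]\le \delta=\sqrt{\frac{4\mu}{\beta-0.5-\mu}}$; 2) $\displaystyle\sum_{t\in V} x_{it}\cdot w_{it}\cdot \mathbf 1[w_{it}>\beta\cdot \mathrm{LP}_i(x)]\le \frac{0.5+\mu}{1-\delta}\cdot \mathrm{LP}_i(x)$.
   Context: $U$ and $V$ are finite sets (offline and online vertices of a bipartite graph), $w_{it}\ge0$ are edge weights and $p_t\in[0,1]$ are probabilities, for $i\in U$, $t\in V$. $\mathcal P$ is the set of $x=(x_{it})_{i\in U,t\in V}$ with $x_{it}\ge0$, $\sum_{i\in U}x_{it}\le p_t$ for all $t\in V$, and $\sum_{t\in V}x_{it}\le1$ for all $i\in U$. For $x\in\mathcal P$, $\mathrm{LP}_i(x)=\sum_{t\in V} w_{it}x_{it}$ and $$\mathrm{LB}_i(x)=\max_{\tau}\ \sum_{t:\ w_{it}\ge\tau}\ \Big(\prod_{s:\ \tau\le w_{is}<w_{it}}(1-x_{is})\Big)\, x_{it}\, w_{it},$$ a lower bound on the expected weight collected at offline vertex $i$ by the best fixed-threshold algorithm (accept the first proposed edge of weight at least $\tau$) when each online vertex $t$ independently proposes to $i$ with probability $x_{it}$. One always has $\mathrm{LB}_i(x)\ge 0.5\cdot\mathrm{LP}_i(x)$,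 so the hypothesis can only hold for $\mu>0$.
   Formalization: Part 2 is stated only for δ < 1; for δ > 1 the right-hand side is negative while the left-hand side is nonnegative, so the printed bound fails, and for δ = 1 it is undefined. *)

(* Defs.v *)
From HB Require Import structures.
From mathcomp Require Import all_boot all_order all_algebra.
From mathcomp Require Import boolp classical_sets reals.
Set Implicit Arguments.
Unset Strict Implicit.
Unset Printing Implicit Defensive.
Import Order.TTheory GRing.Theory Num.Theory.
Local Open Scope ring_scope.
Local Open Scope classical_set_scope.

Definition polytope (R : realType) (U V : finType) (p : V -> R) :
    set (U -> V -> R) :=
  [set x | [/\ forall i t, 0 <= x i t,
               forall t, \sum_(i : U) x i t <= p t
             & forall i, \sum_(t : V) x i t <= 1]].

Definition LP (R : realType) (U V : finType) (w x : U -> V -> R) (i : U) : R :=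
  \sum_(t : V) w i t * x i t.

Definition threshold_value (R : realType) (U V : finType)
    (w x : U -> V -> R) (i : U) (tau : R) : R :=
  \sum_(t : V | tau <= w i t)
     (\prod_(s : V | tau <= w i s < w i t) (1 - x i s)) * x i t * w i t.

(* The maximum ranges over all real thresholds; it is written as a supremum,
   which is attained: see LB_attained and LB_ub. *)
Definition LB (R : realType) (U V : finType) (w x : U -> V -> R) (i : U) : R :=
  sup (range (threshold_value w x i)).

Lemma LB_max (R : realType) (U V : finType) (w x : U -> V -> R) (i : U) :
  exists2 tau0 : R, LB w x i = threshold_value w x i tau0 &
    forall tau : R, threshold_value w x i tau <= threshold_value w x i tau0.
Proof.
pose S (tau : R) : {set V} := [set t | tau <= w i t]%SET.
pose h (A : {set V}) : R := \sum_(t in A)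
  (\prod_(s in A | w i s < w i t) (1 - x i s)) * x i t * w i t.
have gh tau : threshold_value w x i tau = h (S tau).
  rewrite /threshold_value /h; apply: eq_big => [t|t _]; first by rewrite inE.
  by congr (_ * _ * _); apply: eq_bigl => s; rewrite inE.
have P0 : `[< exists tau, S 0 = S tau >] by apply/asboolP; exists 0.
have [A /asboolP[tau0 ->] maxA] :=
  @Order.TotalTheory.arg_maxP _ R _ (S 0)
    (fun A => `[< exists tau, A = S tau >]) h P0.
have ub tau : threshold_value w x i tau <= threshold_value w x i tau0.
  by rewrite !gh; apply: maxA; apply/asboolP; exists tau.
exists tau0 => //; apply/eqP; rewrite eq_le; apply/andP; split.
  by apply: ge_sup => [|_ [tau _ <-]]; [exists (threshold_value w x i 0), 0|].
apply: ub_le_sup; last by exists tau0.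
by exists (threshold_value w x i tau0) => _ [tau _ <-].
Qed.

Lemma LB_attained (R : realType) (U V : finType) (w x : U -> V -> R) (i : U) :
  exists tau : R, LB w x i = threshold_value w x i tau.
Proof. by have [tau0 eLB _] := LB_max w x i; exists tau0. Qed.

Lemma LB_ub (R : realType) (U V : finType) (w x : U -> V -> R) (i : U)
    (tau : R) : threshold_value w x i tau <= LB w x i.
Proof. by have [tau0 -> ub] := LB_max w x i. Qed.

(* Main.v *)
Require Import Defs.
From HB Require Import structures.
From mathcomp Require Import all_boot all_order all_algebra.
From mathcomp Require Import boolp classical_sets reals.
From mathcomp Require Import ring lra.
Set Implicit Arguments.
Unset Strict Implicit.
Unset Printing Implicit Defensive.
Import Order.TTheory GRing.Theory Num.Theory.
Local Open Scope ring_scope.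

(** Write c = 1/2 + mu, L = LP_i(x), and let the vertices be proposed in
    increasing order of weight. For the threshold tau = c L, let r_t be the
    probability that t is reached, P the probability that nothing is accepted,
    and H the set of vertices of weight above beta L, with total mass q.
    The accepted weight equals
      tau * sum_t x_t r_t + sum_t x_t r_t (w_t - tau),
    where sum_t x_t r_t >= 1 - P and r_t >= P, so it is at least
    c L - 2 mu P L. The vertices of H come last: if P = P_low P_H, then the
    excess of r_t over P on H contributes a further
    (beta - c) L P_low (1 - P_H (1 + q)). Since P_H (1 + q + q^2/2) <= 1,
    the bound LB < c L forces q^2 (beta - c) <= 4 mu. For the second claim, use
    the smallest weight of H as threshold: every vertex of H is then reached
    with probability at least 1 - q. *)

Lemma prodB1_ge0 (R : realDomainType) (I : Type) (r : seq I) (P : pred I)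
    (x : I -> R) : (forall s, x s <= 1) -> 0 <= \prod_(s <- r | P s) (1 - x s).
Proof. by move=> x_le1; apply: prodr_ge0 => s _; rewrite subr_ge0. Qed.

Lemma prodB1_le1 (R : realDomainType) (I : Type) (r : seq I) (P : pred I)
    (x : I -> R) : (forall s, 0 <= x s <= 1) ->
  \prod_(s <- r | P s) (1 - x s) <= 1.
Proof.
move=> x01; apply: prodr_ile1 => s _.
by have := x01 s; rewrite subr_ge0 lerBlDr lerDl => /andP[-> ->].
Qed.

(** Union bound for independent proposals. *)
Lemma prodB1_ge_1Bsum (R : realDomainType) (I : Type) (r : seq I) (P : pred I)
    (x : I -> R) : (forall s, 0 <= x s <= 1) ->
  1 - \sum_(s <- r | P s) x s <= \prod_(s <- r | P s) (1 - x s).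
Proof.
move=> x01; elim: r => [|a r IH]; first by rewrite !big_nil subr0.
rewrite !big_cons; case: (P a) => //.
have /andP[a0 a1] := x01 a.
have := prodB1_le1 r P x01.
set p := \prod_(_ <- _ | _) _ in IH *; set S := \sum_(_ <- _ | _) _ in IH *.
by move=> p1; nra.
Qed.

(* Division-free form of exp q >= 1 + q + q^2/2. *)
Lemma prodB1_mul_le (R : realFieldType) (I : Type) (r : seq I) (P : pred I)
    (x : I -> R) (q := \sum_(s <- r | P s) x s) :
  (forall s, 0 <= x s <= 1) ->
  (\prod_(s <- r | P s) (1 - x s)) * (1 + q + q ^+ 2 / 2) <= 1.
Proof.
rewrite /q => {q} x01; have x_le1 s : x s <= 1 by case/andP: (x01 s).
elim: r => [|a r IH]; first by rewrite !big_nil expr0n mul0r !addr0 mulr1.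
rewrite !big_cons; case: (P a) => //.
have /andP[a0 a1] := x01 a.
have S0 : 0 <= \sum_(s <- r | P s) x s.
  by apply: sumr_ge0 => s _; case/andP: (x01 s).
have := prodB1_ge0 r P x_le1.
set p := \prod_(_ <- _ | _) _ in IH *.
set S := \sum_(_ <- _ | _) _ in IH S0 *.
set b := x a in a0 a1 *; move=> p0; apply: le_trans IH.
rewrite [_ * p]mulrC -mulrA ler_wpM2l // -subr_ge0.
(* The degree-two and degree-three terms left after expansion all have nonnegative coefficients. *)
have -> : 1 + S + S ^+ 2 / 2 - (1 - b) * (1 + (b + S) + (b + S) ^+ 2 / 2)
  = (b * S ^+ 2 + b ^+ 2 + 2 * (b ^+ 2 * S) + b ^+ 3) / 2 by field.
by rewrite divr_ge0 // !addr_ge0 ?mulr_ge0 ?exprn_ge0.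
Qed.

(** Probability that no vertex of [A] lighter than [t] proposes. An arbitrary set [A], rather than a
    threshold, allows removing a vertex in inductions and restricting to [H]. *)
Definition reach (R : realType) (V : finType) (w x : V -> R) (A : {set V})
  (t : V) : R := \prod_(s in A | w s < w t) (1 - x s).

Lemma threshold_valueE (R : realType) (U V : finType) (w x : U -> V -> R)
    (i : U) (tau : R) :
  threshold_value w x i tau =
  \sum_(t in [set t | tau <= w i t]%SET)
    reach (w i) (x i) [set t | tau <= w i t]%SET t * x i t * w i t.
Proof.
apply: eq_big => [t|t _]; first by rewrite inE.
by congr (_ * _ * _); apply: eq_bigl => s; rewrite inE.
Qed.

Lemma reach_ge0 (R : realType) (V : finType) (w x : V -> R) (A : {set V}) t :
  (forall s, x s <= 1) -> 0 <= reach w x A t.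
Proof. exact: prodB1_ge0. Qed.

Lemma reach_ge_prod (R : realType) (V : finType) (w x : V -> R)
    (A : {set V}) t : (forall s, 0 <= x s <= 1) ->
  \prod_(s in A) (1 - x s) <= reach w x A t.
Proof.
move=> x01; have x_le1 s : x s <= 1 by case/andP: (x01 s).
rewrite (bigID (fun s => w s < w t)) /= ler_piMr ?reach_ge0 //.
exact: prodB1_le1.
Qed.

Lemma reach_ge_1Bsum (R : realType) (V : finType) (w x : V -> R)
    (A : {set V}) t : (forall s, 0 <= x s <= 1) ->
  1 - \sum_(s in A) x s <= reach w x A t.
Proof.
move=> x01; apply: le_trans (reach_ge_prod _ _ _ x01).
exact: prodB1_ge_1Bsum.
Qed.

(* Only an inequality: vertices of equal weight do not block each other in
   [threshold_value]. *)
Lemma sum_reach_ge (R : realType) (V : finType) (w x : V -> R) (A : {set V}) :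
  (forall s, 0 <= x s <= 1) ->
  1 - \prod_(s in A) (1 - x s) <= \sum_(t in A) x t * reach w x A t.
Proof.
move=> x01; have x_le1 s : x s <= 1 by case/andP: (x01 s).
have [n] := ubnP #|A|; elim: n A => // n IH A An.
have [->|[t0 At0]] := set_0Vmem A; first by rewrite !big_set0 subrr.
(* A heaviest vertex blocks no other, so removing it leaves the other reach probabilities
   unchanged. *)
have [t tA t_max] := @Order.TotalTheory.arg_maxP _ R _ t0 (mem A) w At0.
have At : t \in A by exact: tA.
have /IH {}IH : (#|A :\ t| < n)%N by move: An; rewrite (cardsD1 t A) At.
rewrite !(big_setD1 t At) /=.
have -> : \sum_(s in A :\ t) x s * reach w x A s
        = \sum_(s in A :\ t) x s * reach w x (A :\ t) s.
  apply: eq_bigr => s; rewrite !inE => /andP[_ As]; congr (_ * _).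
  apply: eq_bigl => u; rewrite !inE; case: eqVneq => //= ->.
  by rewrite At ltNge; apply/negbF; exact: t_max.
have le_reach : \prod_(s in A :\ t) (1 - x s) <= reach w x A t.
  apply: le_trans (reach_ge_prod w _ t x01) _.
  rewrite le_eqVlt; apply/orP; left; apply/eqP; apply: eq_bigl => u.
  by rewrite !inE; case: eqVneq => //= ->; rewrite ltxx andbF.
have xt0 : 0 <= x t by case/andP: (x01 t).
apply: le_trans (lerD (ler_wpM2l xt0 le_reach) IH).
by rewrite le_eqVlt; apply/orP; left; apply/eqP; ring.
Qed.

Lemma reach_above (R : realType) (V : finType) (w x : V -> R)
    (A H : {set V}) t : H \subset A ->
  (forall s, s \in A :\: H -> w s < w t) ->
  reach w x A t = \prod_(s in A :\: H) (1 - x s) * reach w x H t.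
Proof.
move=> HA low; rewrite /reach (bigID (mem H)) /= mulrC; congr (_ * _).
  apply: eq_bigl => s; have := low s; rewrite !inE.
  by case: (s \in A); case: (s \in H) => //=; rewrite ?andbT ?andbF // => ->.
apply: eq_bigl => s; case: (boolP (s \in H)) => [Hs|_]; rewrite ?andbF //.
by rewrite (fintype.subsetP HA) // andbT.
Qed.

(** Writing the weight as [tau + (w t - tau)] and the reach probability as [P + (reach w x A t - P)]
    gives three sums, bounded below by the three terms in order. *)
Lemma sum_reach_weight_ge (R : realType) (V : finType) (w x : V -> R)
    (tau b L : R) (A := [set t | tau <= w t]%SET) (H := [set t | b < w t]%SET)
    (Plow := \prod_(s in A :\: H) (1 - x s)) (PH := \prod_(s in H) (1 - x s)) :
  (forall t, 0 <= x t <= 1) -> \sum_t x t <= 1 -> L = \sum_t w t * x t ->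
  0 <= tau <= b ->
  tau * (1 - Plow * PH) + Plow * PH * (L - tau)
    + (b - tau) * (Plow * (1 - PH * (1 + \sum_(t in H) x t)))
  <= \sum_(t in A) reach w x A t * x t * w t.
Proof.
move=> x01 sum_x LE /andP[tau0 tau_b].
have x_ge0 s : 0 <= x s by case/andP: (x01 s).
have x_le1 s : x s <= 1 by case/andP: (x01 s).
have HA : H \subset A.
  by apply/fintype.subsetP => t; rewrite !inE => /ltW; exact: le_trans.
have low s t : s \in A :\: H -> t \in H -> w s < w t.
  by rewrite !inE -leNgt => /andP[sb _]; exact: le_lt_trans.
have PE : \prod_(s in A) (1 - x s) = Plow * PH.
  by rewrite (big_setID H) /= (finset.setIidPr HA) mulrC.
have Plow0 : 0 <= Plow by exact: prodB1_ge0.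
have PH0 : 0 <= PH by exact: prodB1_ge0.
set P := Plow * PH.
have P0 : 0 <= P by exact: mulr_ge0.
have -> : \sum_(t in A) reach w x A t * x t * w t =
    tau * (\sum_(t in A) x t * reach w x A t)
    + P * (\sum_(t in A) x t * (w t - tau))
    + \sum_(t in A) x t * (w t - tau) * (reach w x A t - P).
  rewrite !mulr_sumr -!big_split /=; apply: eq_bigr => t _; ring.
apply: lerD; first apply: lerD.
- by rewrite ler_wpM2l // /P -PE sum_reach_ge.
- apply: ler_wpM2l => //.
  (* Terms outside [A] are nonpositive; the total mass is at most 1 and [0 <= tau]. *)
  apply: (@le_trans _ _ (\sum_t x t * (w t - tau))).
    rewrite (eq_bigr (fun t => w t * x t - x t * tau)); last by move=> t _; ring.
    by rewrite sumrB -LE -mulr_suml lerD2l lerN2 ler_piMl.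
  rewrite [leLHS](bigID (mem A)) /= gerDl sumr_le0 // => t.
  by rewrite inE -ltNge => /ltW tA; rewrite mulr_ge0_le0 // subr_le0.
(* The part of [A] outside [H] contributes a nonnegative amount and is dropped. *)
- rewrite [leRHS](big_setID H) /= (finset.setIidPr HA) -[leLHS]addr0; apply: lerD; last first.
    apply: sumr_ge0 => t; rewrite !inE => /andP[_ tA].
    by rewrite !mulr_ge0 ?subr_ge0 // /P -PE reach_ge_prod.
  apply: (@le_trans _ _ (\sum_(t in H)
      (b - tau) * (Plow * (x t * (reach w x H t - PH))))).
    rewrite -!mulr_sumr; apply: ler_wpM2l; first by rewrite subr_ge0.
    apply: ler_wpM2l => //.
    under [leRHS]eq_bigr => t _ do rewrite mulrBr.
    rewrite sumrB -mulr_suml.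
    have := @sum_reach_ge _ _ w x H x01; rewrite -/PH; lra.
  apply: ler_sum => t Ht.
  rewrite (reach_above _ HA); last by move=> s ?; exact: low.
  rewrite /P -mulrBr -/Plow.
  have -> : x t * (w t - tau) * (Plow * (reach w x H t - PH))
     = (w t - tau) * (Plow * (x t * (reach w x H t - PH))) by ring.
  apply: ler_wpM2r.
    by rewrite !mulr_ge0 // subr_ge0 reach_ge_prod.
  by rewrite lerD2r ltW //; move: Ht; rewrite inE.
Qed.

Lemma threshold_value_ge_high (R : realType) (U V : finType)
    (w x : U -> V -> R) (i : U) (b : R) (H := [set t | b < w i t]%SET) :
  (forall t, 0 <= w i t) -> (forall t, 0 <= x i t <= 1) ->
  exists tau, (1 - \sum_(t in H) x i t) * (\sum_(t in H) x i t * w i t)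
    <= threshold_value w x i tau.
Proof.
move=> w0 x01.
have x_ge0 s : 0 <= x i s by case/andP: (x01 s).
have x_le1 s : x i s <= 1 by case/andP: (x01 s).
have [H0|[t0 Ht0]] := set_0Vmem H.
  exists 0; rewrite H0 !big_set0 mulr0 threshold_valueE sumr_ge0 // => t _.
  by rewrite !mulr_ge0 ?reach_ge0.
have [m mH m_min] := @Order.TotalTheory.arg_minP _ R _ t0 (mem H) (w i) Ht0.
have Hm : m \in H by exact: mH.
exists (w i m); rewrite threshold_valueE.
(* [H] is closed upwards in weight, so its least weight as threshold selects exactly [H]. *)
have -> : [set t | w i m <= w i t]%SET = H.
  apply/setP => t; apply/idP/idP => [|/m_min]; rewrite !inE //.
  by apply: lt_le_trans; move: Hm; rewrite inE.
rewrite mulr_sumr; apply: ler_sum => t Ht; rewrite -mulrA.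
by rewrite ler_wpM2r ?mulr_ge0 ?reach_ge_1Bsum.
Qed.

Theorem lemma4p1 (R : realType) (U V : finType)
    (w : U -> V -> R) (p : V -> R)
    (w_ge0 : forall i t, 0 <= w i t)
    (p_prob : forall t, 0 <= p t <= 1)
    (i : U) (x : U -> V -> R) (xP : polytope p x)
    (mu beta : R) (mu_lt : mu < 1 / 2) (beta_gt : 1 / 2 + mu < beta)
    (hLB : LB w x i < (1 / 2 + mu) * LP w x i) :
  let delta : R := Num.sqrt (4 * mu / (beta - 1 / 2 - mu)) in
  \sum_(t : V) x i t * (beta * LP w x i < w i t)%R%:R <= delta
  /\
  (delta < 1 ->
   \sum_(t : V) x i t * w i t * (beta * LP w x i < w i t)%R%:R
     <= (1 / 2 + mu) / (1 - delta) * LP w x i).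
Proof.
move=> delta; have [x_ge0 _ sum_x] := xP.
have x01 t : 0 <= x i t <= 1.
  rewrite x_ge0 /=; apply: le_trans (sum_x i).
  by rewrite (bigD1 t) //= lerDl sumr_ge0.
set L := LP w x i in hLB *; set c := 1 / 2 + mu in beta_gt hLB *.
pose H := [set t | beta * L < w i t]%SET.
have indE (F : V -> R) :
    \sum_t F t * (beta * L < w i t)%R%:R = \sum_(t in H) F t.
  rewrite [RHS]big_mkcond; apply: eq_bigr => t _.
  by rewrite inE; case: ifP; rewrite (mulr1, mulr0).
rewrite !indE; set q := \sum_(t in H) x i t.
have q0 : 0 <= q by exact: sumr_ge0.
have LE : L = \sum_t w i t * x i t by [].
have L_ge0 : 0 <= L by rewrite LE sumr_ge0 // => t _; exact: mulr_ge0.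
(* Threshold values are nonnegative, hence so is [LB]; the strict hypothesis then gives [L != 0]. *)
have cL0 : 0 < c * L.
  apply: le_lt_trans (le_lt_trans (LB_ub w x i 0) hLB).
  rewrite threshold_valueE sumr_ge0 // => t _.
  by rewrite !mulr_ge0 ?reach_ge0 // => s; case/andP: (x01 s).
have L0 : 0 < L.
  by rewrite lt_neqAle L_ge0 andbT; apply: contraTneq cL0 => <-; rewrite mulr0 ltxx.
have q_le : q <= delta.
  have cb : 0 <= c * L <= beta * L by rewrite ltW //= ler_wpM2r // ltW.
  have := sum_reach_weight_ge x01 (sum_x i) LE cb.
  rewrite -threshold_valueE => /le_lt_trans/(_ (le_lt_trans (LB_ub _ _ _ _) hLB)).
  set Plow := \prod_(s in _ :\: _) _.
  set PH := \prod_(s in _) _.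
  have PHq : PH * (1 + q + q ^+ 2 / 2) <= 1 by exact: prodB1_mul_le.
  have PH0 : 0 <= PH by apply: prodB1_ge0 => s; case/andP: (x01 s).
  have Plow0 : 0 <= Plow by apply: prodB1_ge0 => s; case/andP: (x01 s).
  rewrite -/q => gain.
  (* With [tau = c * L], the first two terms sum to [c * L - 2 * mu * Plow * PH * L], as
     [1 - 2 * c = - 2 * mu]. *)
  have {gain} : L * (Plow * ((beta - c) * (1 - PH * (1 + q)) - PH * (2 * mu))) < 0.
    rewrite -(ltrD2r (c * L)) add0r; apply: le_lt_trans gain.
    by rewrite le_eqVlt; apply/orP; left; apply/eqP; rewrite /c; field.
  rewrite pmulr_rlt0 // => gain.
  (* A negative product with [Plow] nonnegative forces the other factor to be negative. *)
  have {gain} gain : (beta - c) * (1 - PH * (1 + q)) < PH * (2 * mu).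
    rewrite -subr_lt0 ltNge; apply/negP => /(mulr_ge0 Plow0).
    by rewrite leNgt gain.
  have bc0 : 0 < beta - c by rewrite subr_gt0.
  (* [PHq] says that [PH * (q ^+ 2 / 2)] is at most [1 - PH * (1 + q)]. *)
  have {}gain : PH * ((beta - c) * (q ^+ 2 / 2)) < PH * (2 * mu).
    apply: le_lt_trans gain.
    rewrite mulrCA ler_wpM2l ?(ltW bc0) //; move: PHq; lra.
  have {}gain : (beta - c) * (q ^+ 2 / 2) < 2 * mu.
    by rewrite ltNge; apply/negP => /(ler_wpM2l PH0); rewrite leNgt gain.
  rewrite /delta; have -> : beta - 1 / 2 - mu = beta - c by rewrite /c; ring.
  rewrite -[q in leLHS]ger0_norm // -sqrtr_sqr ler_wsqrtr //.
  by rewrite ler_pdivlMr //; move: gain; lra.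
split=> // delta1.
have [tau le_tau] := threshold_value_ge_high (beta * L) (w_ge0 i) x01.
(* After clearing the denominator, [q <= delta] lets [1 - q] replace [1 - delta]. *)
rewrite mulrAC ler_pdivlMr ?subr_gt0 // mulrC.
apply: le_trans (ltW (le_lt_trans (LB_ub _ _ _ _) hLB)).
apply: le_trans le_tau; apply: ler_wpM2r; last by rewrite lerD2l lerN2.
by apply: sumr_ge0 => t _; exact: mulr_ge0.
Qed.
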